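(* Let $T_1,T_2,T_3,T_4\in \mathcal{L}_A(\mathcal{H})$. Then $$w_{\mathbb{A}}\left(\begin{bmatrix} T_1 & T_2\\ T_3 & T_4\end{bmatrix}\right)\geq \max\left\{w_A(T_1),\ w_A(T_4),\ \frac{1}{\sqrt{2}}\left(w_A(T_2T_3+T_3T_2)\right)^{\frac12},\ \frac{1}{\sqrt{2}}\left(w_A(T_2T_3-T_3T_2)\right)^{\frac12}\right\}.$$
   Context: $\mathcal{H}$ is a complex Hilbert space with inner product $\langle\cdot,\cdot\rangle$, and $\mathcal{L}(\mathcal{H})$ is the algebra of bounded linear operators on $\mathcal{H}$. $A\in\mathcal{L}(\mathcal{H})$ is a fixed positive operator, i.e. $A=A^*$ and $\langle Ax,x\rangle\ge 0$ for all $x\in\mathcal{H}$ ($A$ need not be injective). Put $\langle x,y\rangle_A=\langle Ax,y\rangle$ and $\|x\|_A=\sqrt{\langle x,x\rangle_A}$ (a seminorm). $\mathcal{R}(\cdot)$ denotes the range, and $\mathcal{L}_A(\mathcal{H})=\{T\in\mathcal{L}(\mathcal{H}):\mathcal{R}(T^*A)\subseteq\mathcal{R}(A)\}$ (the operators admitting an $A$-adjoint, i.e. an $X\in\mathcal{L}(\mathcal{H})$ with $AX=T^*A$); it is a subalgebra of $\mathcal{L}(\mathcal{H})$. For $T\in\mathcal{L}_A(\mathcal{H})$ the $A$-numerical radius is $w_A(T)=\sup\{|\langle Tx,x\rangle_A| : x\in\mathcal{H},\ \|x\|_A=1\}$. $\mathbb{A}=\begin{bmatrix} A&0\\0&A\end{bmatrix}$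 is the positive diagonal operator on $\mathcal{H}\oplus\mathcal{H}$, and $w_{\mathbb{A}}$ is the numerical radius defined in the same way with $(\mathcal{H}\oplus\mathcal{H},\mathbb{A})$ in place of $(\mathcal{H},A)$. *)

(* Defs.v *)
From HB Require Import structures.
From mathcomp Require Import all_boot all_order all_algebra sesquilinear complex.
From mathcomp Require Import all_classical all_reals all_analysis.

Set Implicit Arguments.
Unset Strict Implicit.
Unset Printing Implicit Defensive.

Import Order.TTheory GRing.Theory Num.Theory.
Import numFieldNormedType.Exports.

Local Open Scope classical_set_scope.
Local Open Scope ring_scope.

Notation inner_product U := {dot U for Num.conj}.

Section DirectSum.
Variables (R : realType) (U : lmodType R[i]) (dot : inner_product U).

Definition dsum_dot (x y : U * U) : R[i] := dot x.1 y.1 + dot x.2 y.2.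

Lemma dsum_dot_bilinear :
  bilinear_for (GRing.Scale.Law.clone _ _ *%R _)
    (GRing.Scale.Law.clone _ _ (Num.conj \; *%R) _) dsum_dot.
Proof.
split=> [y a u v | x a u v]; rewrite /dsum_dot /=.
- by rewrite !linearPl addrACA -mulrDr.
- by rewrite !linearPr /= addrACA -mulrDr.
Qed.

HB.instance Definition _ :=
  bilinear_isBilinear.Build R[i] (U * U)%type (U * U)%type R[i]
    *%R (Num.conj \; *%R) dsum_dot dsum_dot_bilinear.

Lemma dsum_dot_hermitian (x y : U * U) :
  dsum_dot x y = (-1) ^+ false * Num.conj (dsum_dot y x).
Proof.
by rewrite /dsum_dot rmorphD mulrDr; congr (_ + _); exact: hermitian_subproof.
Qed.

HB.instance Definition _ :=
  isHermitianSesquilinear.Build R[i] (U * U)%type false Num.conj dsum_dot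
    dsum_dot_hermitian.

Lemma dsum_dot_gt0 (u : U * U) : u != 0 -> 0 < dsum_dot u u.
Proof.
have ge0 v : 0 <= dot v v.
  have [->|/neq0_dnorm_gt0/ltW//] := eqVneq v 0.
  by rewrite linear0l.
case: u => u v; rewrite xpair_eqE negb_and /dsum_dot /= => /orP[] h.
- by apply: ltr_pwDl; [exact: neq0_dnorm_gt0 | exact: ge0].
- by apply: ltr_wpDl; [exact: ge0 | exact: neq0_dnorm_gt0].
Qed.

HB.instance Definition _ :=
  isDotProduct.Build R[i] (U * U)%type dsum_dot dsum_dot_gt0.

End DirectSum.

(* [[T1, T2], [T3, T4]] acting on U (+) U *)
Definition block_op (U : nmodType) (T1 T2 T3 T4 : U -> U) (x : U * U) : U * U :=
  (T1 x.1 + T2 x.2, T3 x.1 + T4 x.2).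

Section NumericalRadius.
Variables (R : realType) (U : lmodType R[i]) (dot : inner_product U).
Variable A : U -> U.

Definition Adot (x y : U) : R[i] := dot (A x) y.

Definition Anorm (x : U) : R[i] := sqrtC (Adot x x).

(* A modulus `|z| of z : R[i] is an element of R[i] with zero imaginary part,
   so Re only changes its type.  The supremum is taken in R: it is 0 on the
   empty set (A = 0), and the set is bounded above when T has an A-adjoint. *)
Definition Anumradius (T : U -> U) : R :=
  sup [set complex.Re `|Adot (T x) x| | x in [set x | Anorm x = 1]].

End NumericalRadius.

Section HilbertOperators.
Variables (R : realType) (H : completeNormedModType R[i]).
Variable dot : inner_product H.

Definition bounded_op (T : {linear H -> H}) : Prop :=
  bounded_near T (nbhs (0 : H)).

Definition is_adjoint (T S : H -> H) : Prop :=
  forall x y, dot (T x) y = dot x (S y).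

Definition positive_op (A : H -> H) : Prop :=
  is_adjoint A A /\ forall x, 0 <= dot (A x) x.

(* T^* is unique since dot is definite, and it exists for every bounded T by the
   Riesz representation theorem: the existential only names it. *)
Definition A_adjointable (A : H -> H) (T : {linear H -> H}) : Prop :=
  bounded_op T /\
  exists Tstar : {linear H -> H},
    [/\ bounded_op Tstar, is_adjoint T Tstar &
        range (Tstar \o A) `<=` range A].

End HilbertOperators.

(* Main.v *)
Require Import Defs.
From HB Require Import structures.
From mathcomp Require Import all_boot all_order all_algebra sesquilinear complex.
From mathcomp Require Import all_classical all_reals all_analysis.
From mathcomp Require Import ring lra.

(** Compressing to the first or second summand gives [w T1, w T4 <= w], and
    averaging with the conjugate by diag(1, -1) shows that the off-diagonal
    part [B] also has numerical radius at most [w].  Since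
    [B ^ 2 = diag(T2 T3, T3 T2)], the power inequality [w(B ^ 2) <= w(B) ^ 2]
    bounds both [w(T2 T3)] and [w(T3 T2)] by [w ^ 2].

    The supremum defining [w] is only meaningful if it is finite, i.e. if an
    operator with an A-adjoint is bounded for the seminorm.  Uniform
    boundedness turns the inclusion of [R(T^* A)] in [R(A)] into
    [|A T x| <= C |A x|], and Krein's iteration of Cauchy-Schwarz on the
    symmetrizable operator [S = X T], with [A X = T^* A], concludes. *)

Set Implicit Arguments.
Unset Strict Implicit.
Unset Printing Implicit Defensive.

Import Order.TTheory GRing.Theory Num.Theory.
Import numFieldNormedType.Exports.

Local Open Scope classical_set_scope.
Local Open Scope ring_scope.

(** * Real parts and unimodular factors of complex numbers *)

Section ComplexParts.
Variable R : realType.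
Implicit Types z : R[i].

Lemma Re_add z1 z2 : complex.Re (z1 + z2) = complex.Re z1 + complex.Re z2.
Proof. by case: z1; case: z2. Qed.

Lemma Re_scale (t : R) z : complex.Re (t%:C%C * z) = t * complex.Re z.
Proof. by case: z => x y; simpc. Qed.

Lemma Re_conj z : complex.Re (Num.conj z) = complex.Re z.
Proof. by case: z. Qed.

Lemma ReK z : 0 <= z -> (complex.Re z)%:C%C = z.
Proof. by move=> /ger0_real /RRe_real. Qed.

Lemma Re_le_norm z : complex.Re z <= complex.Re `|z|.
Proof.
rewrite -lecR (ReK (normr_ge0 z)); apply: le_trans (normc_ge_Re z).
by rewrite lecR ler_norm.
Qed.

Lemma norm_phase z : exists2 u : R[i], `|u| = 1 & u * z = `|z|.
Proof.
have [->|z0] := eqVneq z 0; first by exists 1; rewrite ?normr1 // mulr0 normr0.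
have nz0 : `|z| != 0 by rewrite normr_eq0.
exists (`|z| / z); last by rewrite divfK.
by rewrite normrM normr_id normfV mulfV.
Qed.

Lemma phase_sqrt (u : R[i]) :
  `|u| = 1 -> exists2 v : R[i], `|v| = 1 & v ^+ 2 = u.
Proof.
move=> u1; exists (sqrtC u); last exact: sqrtCK.
have v2 : `|sqrtC u| ^+ 2 = 1 by rewrite -normrX sqrtCK.
by apply/eqP; rewrite -(@eqrXn2 _ 2) // ?expr1n ?v2.
Qed.

End ComplexParts.

(** * The semi-inner product of [A] and the power inequality for squares *)

Section SemiInnerProduct.
Variables (R : realType) (U : lmodType R[i]) (dot : inner_product U).
Variable A : {linear U -> U}.
Hypothesis adjA : forall x y, dot (A x) y = dot x (A y).
Hypothesis posA : forall x, 0 <= dot (A x) x.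

(** The real part is a real symmetric form, open to real linear arithmetic; moduli are recovered by
    rotating one argument by a unimodular scalar. *)
Definition Arealdot (x y : U) : R := complex.Re (Adot dot A x y).

Local Notation rdot := Arealdot.

Lemma AdotC x y : Adot dot A x y = Num.conj (Adot dot A y x).
Proof. by rewrite /Adot adjA hermC /= expr0 mul1r. Qed.

Lemma AdotDl x y z : Adot dot A (x + y) z = Adot dot A x z + Adot dot A y z.
Proof. by rewrite /Adot linearD linearDl. Qed.

Lemma AdotZl a x z : Adot dot A (a *: x) z = a * Adot dot A x z.
Proof. by rewrite /Adot linearZ linearZl_LR. Qed.

Lemma AdotZr a x z : Adot dot A x (a *: z) = Num.conj a * Adot dot A x z.
Proof. by rewrite AdotC AdotZl rmorphM (AdotC x). Qed.

Lemma rdotC x y : rdot x y = rdot y x.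
Proof. by rewrite /Arealdot AdotC Re_conj. Qed.

Lemma rdotDl x y z : rdot (x + y) z = rdot x z + rdot y z.
Proof. by rewrite /Arealdot AdotDl Re_add. Qed.

Lemma rdotZl (t : R) x z : rdot (t%:C%C *: x) z = t * rdot x z.
Proof. by rewrite /Arealdot AdotZl Re_scale. Qed.

Lemma rdotNl x z : rdot (- x) z = - rdot x z.
Proof.
have -> : - x = (-1)%:C%C *: x by rewrite rmorphN rmorph1 scaleN1r.
by rewrite rdotZl mulN1r.
Qed.

Lemma rdotDr x y z : rdot z (x + y) = rdot z x + rdot z y.
Proof. by rewrite rdotC rdotDl !(rdotC z). Qed.

Lemma rdotZr (t : R) x z : rdot z (t%:C%C *: x) = t * rdot z x.
Proof. by rewrite rdotC rdotZl rdotC. Qed.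

Lemma rdotNr x z : rdot z (- x) = - rdot z x.
Proof. by rewrite rdotC rdotNl rdotC. Qed.

Definition rdotE := (rdotDl, rdotDr, rdotZl, rdotZr, rdotNl, rdotNr).

Lemma rdot_ge0 x : 0 <= rdot x x.
Proof. by rewrite -ler0c ReK; exact: posA. Qed.

Lemma rdot_phase (a : R[i]) x : `|a| = 1 -> rdot (a *: x) (a *: x) = rdot x x.
Proof.
move=> a1; rewrite /Arealdot AdotZl AdotZr mulrA.
by rewrite -normCK a1 expr1n mul1r.
Qed.

Lemma rdot_amgm x y : `|rdot x y| <= rdot x x + rdot y y.
Proof.
have := rdot_ge0 (x + y); have := rdot_ge0 (x - y).
have := rdot_ge0 x; have := rdot_ge0 y.
rewrite !rdotE (rdotC y x) => *; rewrite ler_norml; apply/andP; split; lra.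
Qed.

Lemma rdot_parallelogram_le x y :
  rdot (x + y) (x + y) <= 2 * (rdot x x + rdot y y).
Proof. by have := rdot_ge0 (x - y); rewrite !rdotE (rdotC y x); lra. Qed.

Lemma rdot_cauchy_schwarz x y : rdot x y ^+ 2 <= rdot x x * rdot y y.
Proof.
have quad t : 0 <= rdot x x + 2 * t * rdot x y + t ^+ 2 * rdot y y.
  have := rdot_ge0 (x + t%:C%C *: y).
  by rewrite !rdotE (rdotC y x); lra.
have := rdot_ge0 y; rewrite le_eqVlt => /orP[/eqP y0|y0].
  (* On a null vector [y] the quadratic is affine in [t]; this [t] gives it the value -1 unless
     [rdot x y = 0]. *)
  have := quad (- (rdot x x + 1) / (2 * rdot x y)).
  have [->|b0] := eqVneq (rdot x y) 0; first by move=> _; rewrite expr0n -y0 mulr0.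
  rewrite -y0 !mulr0 addr0.
  suff -> : 2 * (- (rdot x x + 1) / (2 * rdot x y)) * rdot x y = - (rdot x x + 1).
    by lra.
  by field.
(* The minimiser of the quadratic. *)
have := quad (- rdot x y / rdot y y); rewrite -(pmulr_rge0 _ y0).
suff -> : rdot y y * (rdot x x + 2 * (- rdot x y / rdot y y) * rdot x y
  + (- rdot x y / rdot y y) ^+ 2 * rdot y y) = rdot x x * rdot y y - rdot x y ^+ 2.
  by rewrite subr_ge0.
by field; apply: lt0r_neq0.
Qed.

(* Pearcy's argument: with x1 := w z + v S z and x2 := w z - v S z, where v ^+ 2 = u,
   the sum of the two nonnegative numbers w <x1, x1> - Re v <S x1, x1> and
   w <x2, x2> + Re v <S x2, x2> is 2 w (w ^+ 2 <z, z> - Re u <S (S z), z>). *)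
Lemma numradius_sqr_le (S : {linear U -> U}) (w : R) : 0 <= w ->
  (forall u x, `|u| = 1 -> rdot (u *: S x) x <= w * rdot x x) ->
  forall u x, `|u| = 1 -> rdot (u *: S (S x)) x <= w ^+ 2 * rdot x x.
Proof.
move=> w0 hS u z u1.
have [v v1 vu] := phase_sqrt u1.
(* The identity carries a factor [w] to be cancelled, so the bound is first proved for every
   positive [e >= w]. *)
have pos (e : R) : 0 < e -> w <= e -> rdot (u *: S (S z)) z <= e ^+ 2 * rdot z z.
  move=> e0 we.
  set s := v *: S z; set p := u *: S (S z).
  have hS' k x : `|k| = 1 -> rdot (k *: S x) x <= e * rdot x x.
    by move=> k1; apply: le_trans (hS _ _ k1) _; rewrite ler_wpM2r ?rdot_ge0.
  have := hS' v (e%:C%C *: z + s) v1.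
  have := hS' (- v) (e%:C%C *: z - s); rewrite normrN => /(_ v1).
  have -> : v *: S (e%:C%C *: z + s) = e%:C%C *: s + p.
    have -> : S (e%:C%C *: z + s) = e%:C%C *: S z + v *: S (S z).
      by rewrite linearD !linearZ.
    by rewrite scalerDr !scalerA (mulrC v) -expr2 vu -scalerA.
  have -> : - v *: S (e%:C%C *: z - s) = - (e%:C%C *: s - p).
    have -> : S (e%:C%C *: z - s) = e%:C%C *: S z - v *: S (S z).
      by rewrite linearB !linearZ.
    by rewrite scaleNr scalerBr !scalerA (mulrC v) -expr2 vu -scalerA.
  rewrite !rdotE (rdotC s z) => h1 h2.
  rewrite -(ler_pM2l e0); lra.
have := w0; rewrite le_eqVlt => /orP[/eqP w_eq0|w_gt0]; last exact: pos.
(* For [w = 0], a positive left side [b] satisfies [b <= e ^+ 2 * q] for all [e > 0]. Taking [e = 1]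
   gives [b <= q], and then [e = b / (2 * q)] gives [b <= b / 4]. *)
rewrite -w_eq0 expr0n mul0r leNgt; apply/negP => b0.
have := pos 1 ltr01; rewrite expr1n mul1r -w_eq0 ler01 => /(_ isT) bq.
set b := rdot _ z in b0 bq pos; set q := rdot z z in bq pos.
have q0 : 0 < q by exact: lt_le_trans bq.
have e0 : 0 < b / (2 * q) by rewrite divr_gt0 ?mulr_gt0.
have := pos _ e0; rewrite -w_eq0 (ltW e0) => /(_ isT).
have -> : (b / (2 * q)) ^+ 2 * q = b * (b / q) / 4.
  by field; apply: lt0r_neq0.
have : b / q <= 1 by rewrite ler_pdivrMr ?mul1r.
nra.
Qed.

End SemiInnerProduct.

(** * The numerical radius as a bound on rotated real parts *)

Section NumericalRadiusBounds.
Variables (R : realType) (U : lmodType R[i]) (dot : inner_product U).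
Variable A : {linear U -> U}.
Hypothesis adjA : forall x y, dot (A x) y = dot x (A y).
Hypothesis posA : forall x, 0 <= dot (A x) x.

Local Notation rdot := (Arealdot dot A).

Definition Abounded (T : U -> U) :=
  exists c, forall x, rdot (T x) (T x) <= c * rdot x x.

Lemma Anorm_eq1 x : (Anorm dot A x = 1) <-> (rdot x x = 1).
Proof.
rewrite /Anorm /Arealdot; split=> [x1|x1].
  by rewrite -(sqrtCK (Adot dot A x x)) x1 expr1n.
have := posA x; rewrite -/(Adot dot A x x) => /ReK <-.
by rewrite x1 rmorph1 sqrtC1.
Qed.

Lemma Re_norm_phase (T : U -> U) x : exists2 u : R[i], `|u| = 1 &
  complex.Re `|Adot dot A (T x) x| = rdot (u *: T x) x.
Proof.
have [u u1 uz] := norm_phase (Adot dot A (T x) x).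
by exists u => //; rewrite -uz -AdotZl.
Qed.

Lemma rdot_phase_le_norm u (T : U -> U) x : `|u| = 1 ->
  rdot (u *: T x) x <= complex.Re `|Adot dot A (T x) x|.
Proof.
move=> u1; rewrite /Arealdot AdotZl; apply: le_trans (Re_le_norm _) _.
by rewrite normrM u1 mul1r.
Qed.

Lemma Anumradius_le (T : U -> U) r : 0 <= r ->
  (forall u x, `|u| = 1 -> rdot (u *: T x) x <= r * rdot x x) ->
  Anumradius dot A T <= r.
Proof.
move=> r0 hT; rewrite /Anumradius; set E := (X in sup X).
(* If no vector has A-norm one, [sup] is 0 by convention, and [0 <= r] concludes. *)
have [->|E0] := eqVneq E set0; first by rewrite sup0.
apply: ge_sup; first exact/set0P.
move=> _ [x /Anorm_eq1 x1 <-].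
have [u u1 ->] := Re_norm_phase T x.
by apply: le_trans (hT _ _ u1) _; rewrite x1 mulr1.
Qed.

Lemma Anumradius_ge0 (T : U -> U) : 0 <= Anumradius dot A T.
Proof.
rewrite /Anumradius; set E := (X in sup X).
have [hE|/sup_out -> //] := pselect (has_sup E).
have [y Ey] := hE.1; apply: (le_trans _ (ub_le_sup hE.2 Ey)).
by case: Ey => x _ <-; rewrite -ler0c ReK.
Qed.

(** Boundedness makes the supremum a true upper bound on unit vectors; homogeneity extends it to all
    vectors. *)
Lemma Anumradius_ub (T : {linear U -> U}) : Abounded T ->
  forall u x, `|u| = 1 -> rdot (u *: T x) x <= Anumradius dot A T * rdot x x.
Proof.
move=> [c hc] u x u1.
have := rdot_ge0 posA x; rewrite le_eqVlt => /orP[/eqP x0|x_gt0].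
  (* A null vector cannot be normalised, but Cauchy-Schwarz makes both sides vanish. *)
  have := rdot_cauchy_schwarz adjA posA (u *: T x) x.
  rewrite -x0 !mulr0 => h.
  suff -> : rdot (u *: T x) x = 0 by [].
  by apply/eqP; rewrite -(@sqrf_eq0 R) eq_le h sqr_ge0.
set t := (Num.sqrt (rdot x x))^-1.
have tt : t * t * rdot x x = 1.
  rewrite -invfM -expr2 sqr_sqrtr ?(ltW x_gt0) // mulVf //.
  exact: lt0r_neq0.
set y := t%:C%C *: x.
have y1 : rdot y y = 1 by rewrite rdotZl (rdotZr adjA) mulrA.
have : rdot (u *: T y) y <= Anumradius dot A T.
  apply: le_trans (rdot_phase_le_norm _ _ u1) _.
  apply: ub_le_sup; last by exists y => //=; exact/Anorm_eq1.
  exists (c + 1) => _ [z /Anorm_eq1 z1 <-].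
  have [v v1 ->] := Re_norm_phase T z.
  apply: le_trans (ler_norm _) _; apply: le_trans (rdot_amgm adjA posA _ _) _.
  by rewrite (rdot_phase adjA) // z1 lerD2r; apply: le_trans (hc z) _; rewrite z1 mulr1.
have -> : rdot (u *: T y) y = t * t * rdot (u *: T x) x.
  have -> : T y = t%:C%C *: T x by rewrite linearZ.
  rewrite scalerA mulrC -scalerA.
  by rewrite rdotZl (rdotZr adjA) mulrA.
rewrite -(ler_pM2r x_gt0); apply: le_trans.
by rewrite mulrAC tt mul1r.
Qed.

End NumericalRadiusBounds.

(** * Block operators on the direct sum and their numerical radii *)

Section BlockLinear.
Variables (K : nzRingType) (U : lmodType K) (T1 T2 T3 T4 : {linear U -> U}).

Lemma block_op_linear : linear (block_op T1 T2 T3 T4).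
Proof.
move=> a [x1 x2] [y1 y2]; rewrite /block_op /= !linearP.
by congr (_, _); rewrite /= scalerDr addrACA.
Qed.

HB.instance Definition _ :=
  GRing.isLinear.Build K (U * U)%type (U * U)%type _ (block_op T1 T2 T3 T4)
    block_op_linear.

End BlockLinear.

Section BlockNumericalRadius.
Variables (R : realType) (U : lmodType R[i]) (dot : inner_product U).
Variable A : {linear U -> U}.
Hypothesis adjA : forall x y, dot (A x) y = dot x (A y).
Hypothesis posA : forall x, 0 <= dot (A x) x.

Local Notation rdot := (Arealdot dot A).
Local Notation rdot2 := (Arealdot (dsum_dot dot) (block_op A \0 \0 A)).

(** With the next lemma, this lets the results on [A] be applied to the diagonal operator on the
    direct sum. *)
Lemma block_diag_adj x y :
  dsum_dot dot (block_op A \0 \0 A x) y = dsum_dot dot x (block_op A \0 \0 A y).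
Proof. by rewrite /dsum_dot /block_op /= !addr0 !add0r !adjA. Qed.

Lemma block_diag_ge0 x : 0 <= dsum_dot dot (block_op A \0 \0 A x) x.
Proof. by rewrite /dsum_dot /block_op /= !addr0 !add0r addr_ge0. Qed.

Lemma rdot_block x y : rdot2 x y = rdot x.1 y.1 + rdot x.2 y.2.
Proof.
by rewrite /Arealdot /Adot /= /dsum_dot /block_op /= !addr0 !add0r Re_add.
Qed.

Lemma Abounded_block T1 T2 T3 T4 :
  Abounded dot A T1 -> Abounded dot A T2 ->
  Abounded dot A T3 -> Abounded dot A T4 ->
  Abounded (dsum_dot dot) (block_op A \0 \0 A) (block_op T1 T2 T3 T4).
Proof.
move=> [c1 h1] [c2 h2] [c3 h3] [c4 h4].
(* The 2 comes from the parallelogram inequality; absolute values are taken because the constants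
   may have any sign. *)
exists (2 * (`|c1| + `|c2| + `|c3| + `|c4|)) => -[x y].
rewrite !rdot_block /=.
have := rdot_parallelogram_le adjA posA (T1 x) (T2 y).
have := rdot_parallelogram_le adjA posA (T3 x) (T4 y).
have hx := rdot_ge0 posA x; have hy := rdot_ge0 posA y.
have bd (c r q : R) : 0 <= q -> r <= c * q -> r <= `|c| * q.
  by move=> q0 /le_trans; apply; rewrite ler_wpM2r ?ler_norm.
have {}h1 := bd _ _ _ hx (h1 x); have {}h2 := bd _ _ _ hy (h2 y).
have {}h3 := bd _ _ _ hx (h3 x); have {}h4 := bd _ _ _ hy (h4 y).
have p (c q : R) : 0 <= q -> 0 <= `|c| * q by move=> ?; rewrite mulr_ge0.
have := (p c1 _ hy, p c2 _ hx, p c3 _ hy, p c4 _ hx).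
move=> [[[]]]; lra.
Qed.

Variables T1 T2 T3 T4 : {linear U -> U}.
Hypothesis bnd : Abounded (dsum_dot dot) (block_op A \0 \0 A) (block_op T1 T2 T3 T4).

Local Notation w :=
  (Anumradius (dsum_dot dot) (block_op A \0 \0 A) (block_op T1 T2 T3 T4)).

Let w_ge0 : 0 <= w := Anumradius_ge0 _ _ _.

Lemma block_rdot_le u x y : `|u| = 1 ->
  rdot (u *: (T1 x + T2 y)) x + rdot (u *: (T3 x + T4 y)) y
    <= w * (rdot x x + rdot y y).
Proof.
move=> u1.
have := Anumradius_ub block_diag_adj block_diag_ge0 bnd (x, y) u1.
by rewrite !rdot_block.
Qed.

Lemma Anumradius_block_diagl : Anumradius dot A T1 <= w.
Proof.
apply: (Anumradius_le posA) => // u x u1.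
have := block_rdot_le x 0 u1.
by rewrite !linear0 !addr0 /Arealdot /Adot !linear0r /= !addr0.
Qed.

Lemma Anumradius_block_diagr : Anumradius dot A T4 <= w.
Proof.
apply: (Anumradius_le posA) => // u x u1.
have := block_rdot_le 0 x u1.
by rewrite !linear0 !add0r /Arealdot /Adot !linear0r /= !add0r.
Qed.

(* Conjugation by diag(1, -1) flips the sign of the off-diagonal part only. *)
Lemma block_offdiag_le u z : `|u| = 1 ->
  rdot2 (u *: block_op \0 T2 T3 \0 z) z <= w * rdot2 z z.
Proof.
move=> u1; case: z => x y; rewrite !rdot_block /= add0r addr0.
have := block_rdot_le x y u1.
(* Adding the bounds at [u], [(x, y)] and at [- u], [(x, - y)] cancels the diagonal terms and
   doubles the others. *)
have := @block_rdot_le (- u) x (- y); rewrite normrN => /(_ u1).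
rewrite !linearN !scaleNr !scalerDr !scalerN.
rewrite !(rdotE adjA); lra.
Qed.

Lemma block_offdiag_sqr_le u x : `|u| = 1 ->
  rdot (u *: T2 (T3 x)) x <= w ^+ 2 * rdot x x /\
  rdot (u *: T3 (T2 x)) x <= w ^+ 2 * rdot x x.
Proof.
move=> u1.
have sq := numradius_sqr_le block_diag_adj block_diag_ge0 w_ge0 block_offdiag_le _ u1.
have := sq (x, 0); have := sq (0, x).
rewrite !rdot_block /= !linear0 !addr0 !add0r.
by rewrite /Arealdot /Adot !linear0r /= !addr0 !add0r.
Qed.

Lemma Anumradius_anticommutator_le :
  Anumradius dot A ((T2 \o T3) \+ (T3 \o T2)) <= 2 * w ^+ 2.
Proof.
apply: (Anumradius_le posA) => [|u x u1]; first by rewrite mulr_ge0 ?sqr_ge0.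
have [] := block_offdiag_sqr_le x u1.
by rewrite /= scalerDr !(rdotE adjA); lra.
Qed.

Lemma Anumradius_commutator_le :
  Anumradius dot A ((T2 \o T3) \- (T3 \o T2)) <= 2 * w ^+ 2.
Proof.
apply: (Anumradius_le posA) => [|u x u1]; first by rewrite mulr_ge0 ?sqr_ge0.
have [+ _] := block_offdiag_sqr_le x u1.
(* The minus sign of the commutator is absorbed into the phase. *)
have [_] := @block_offdiag_sqr_le (- u) x (etrans (normrN _) u1).
by rewrite /= scalerBr scaleNr !(rdotE adjA); lra.
Qed.

Lemma sqrt_Anumradius_le (r : R) : r <= 2 * w ^+ 2 ->
  (Num.sqrt 2)^-1 * Num.sqrt r <= w.
Proof.
move=> hr; rewrite ler_pdivrMl ?sqrtr_gt0 //.
apply: le_trans (ler_wsqrtr hr) _.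
by rewrite sqrtrM // sqrtr_sqr ger0_norm.
Qed.

End BlockNumericalRadius.

(** * Growth estimates for Krein's iteration *)

Lemma bernoulli_le (R : realType) (r : R) n : 1 < r -> n%:R * (r - 1) <= r ^+ n.
Proof.
move=> r1; suff : 1 + n%:R * (r - 1) <= r ^+ n by lra.
elim: n => [|n IHn]; first by rewrite mul0r addr0 expr0.
rewrite exprS -natr1.
have n0 : 0 <= n%:R * (r - 1) ^+ 2 by rewrite mulr_ge0 ?sqr_ge0.
have r0 : 0 < r by lra.
have : r * (1 + n%:R * (r - 1)) <= r * r ^+ n by rewrite ler_pM2l.
lra.
Qed.

(* Krein's iteration: the first bound doubles the index, giving
   (a 1 / a 0) ^ (2 ^ n) <= a (2 ^ n) / a 0, which the second bound keeps
   of order D ^ (2 ^ n / 2). *)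
Lemma krein_iteration (R : realType) (a : nat -> R) (D E : R) : 0 < D ->
  (forall m, a m ^+ 2 <= a 0 * a (m * 2)%N) ->
  (forall m, a m ^+ 2 <= D ^+ m * E) ->
  a 1 ^+ 2 <= D * a 0 ^+ 2.
Proof.
move=> D0 dbl bnd.
have [a0|a0] := eqVneq (a 0) 0.
  by have := dbl 1; rewrite a0 mul0r expr0n mulr0.
set x := a 1 ^+ 2; set z := a 0 ^+ 2.
have z0 : 0 < z by rewrite exprn_even_gt0.
have x_ge0 : 0 <= x by exact: sqr_ge0.
rewrite leNgt; apply/negP => xz.
(* The square of [(a 1 / a 0) ^ (2 ^ n) <= a (2 ^ n) / a 0], cleared of denominators; squaring
   avoids any sign condition on [a]. *)
have step n : x ^+ (2 ^ n) * z <= a (2 ^ n)%N ^+ 2 * z ^+ (2 ^ n).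
  elim: n => [|n IHn]; first by rewrite expn0 !expr1.
  rewrite -(ler_pM2r z0) expnSr !exprM.
  have le1 : (x ^+ (2 ^ n) * z) ^+ 2 <= (a (2 ^ n)%N ^+ 2 * z ^+ (2 ^ n)) ^+ 2.
    have zn : 0 <= z ^+ (2 ^ n) by exact/exprn_ge0/ltW.
    have xn : 0 <= x ^+ (2 ^ n) by exact: exprn_ge0.
    rewrite ler_pXn2r ?nnegrE //; first exact: mulr_ge0 xn (ltW z0).
    exact: mulr_ge0 (sqr_ge0 _) zn.
  have -> : (x ^+ (2 ^ n)) ^+ 2 * z * z = (x ^+ (2 ^ n) * z) ^+ 2 by ring.
  apply: le_trans le1 _.
  have -> : a (2 ^ n * 2)%N ^+ 2 * (z ^+ (2 ^ n)) ^+ 2 * z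
      = (a 0 * a (2 ^ n * 2)%N) ^+ 2 * (z ^+ (2 ^ n)) ^+ 2 by rewrite /z; ring.
  rewrite exprMn ler_wpM2r ?sqr_ge0 //.
  rewrite ler_pXn2r ?nnegrE ?sqr_ge0 //.
  exact: le_trans (sqr_ge0 _) (dbl _).
have Dz : 0 < D * z by rewrite mulr_gt0.
set r := x / (D * z).
have r1 : 1 < r by rewrite ltr_pdivlMr ?mul1r.
have rE n : r ^+ (2 ^ n) <= E / z.
  rewrite ler_pdivlMr // /r expr_div_n mulrAC ler_pdivrMr ?exprn_gt0 //.
  apply: le_trans (step n) _; rewrite (exprMn _ D z) [leRHS]mulrCA [leRHS]mulrA.
  by apply: ler_wpM2r; [exact/exprn_ge0/ltW | exact: bnd].
(* Chosen so that [n * (r - 1)] exceeds [E / z]; Bernoulli at exponent [2 ^ n >= n] then contradicts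
   [rE]. *)
pose n := (Num.truncn (E / z / (r - 1))).+1.
have : E / z / (r - 1) < n%:R by exact: truncnS_gt.
rewrite ltr_pdivrMr ?subr_gt0 //; apply/negP; rewrite -leNgt.
apply: le_trans (rE n); apply: le_trans (bernoulli_le _ r1).
by rewrite ler_wpM2r ?subr_ge0 ?(ltW r1) // ler_nat ltnW // ltn_expl.
Qed.

(** * Hilbert space: uniform boundedness and boundedness for the A-seminorm *)

Section HilbertBoundedness.
Variables (R : realType) (H : completeNormedModType R[i]).
Variable dot : inner_product H.
Hypothesis norm_dot : forall x : H, `|x| ^+ 2 = dot x x.

Local Notation b := (Arealdot dot idfun).

Let N (x : H) : R := complex.Re `|x|.

Lemma idfun_adj (x y : H) : dot (idfun x) y = dot x (idfun y).
Proof. by []. Qed.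

Lemma idfun_ge0 (x : H) : 0 <= dot (idfun x) x.
Proof. by rewrite /= -norm_dot exprn_ge0. Qed.

Lemma rnormK x : (N x)%:C%C = `|x|.
Proof. exact: ReK. Qed.

Lemma rnorm_ge0 x : 0 <= N x.
Proof. by rewrite -ler0c rnormK. Qed.

Lemma rnormZ (t : R) x : N (t%:C%C *: x) = `|t| * N x.
Proof.
rewrite /N normrZ.
have -> : `|t%:C%C| = (`|t|)%:C%C :> R[i].
  by rewrite normc_def /= expr0n /= addr0 sqrtr_sqr.
by rewrite Re_scale.
Qed.

Lemma ler_rnormD x y : N (x + y) <= N x + N y.
Proof. by rewrite -lecR rmorphD /= !rnormK ler_normD. Qed.

Lemma rdistC x y : N (x - y) = N (y - x).
Proof. by rewrite /N distrC. Qed.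

Lemma rnorm_sqr x : N x ^+ 2 = b x x.
Proof. by rewrite /Arealdot /Adot /= -norm_dot -rnormK -rmorphXn /=. Qed.

Lemma rdot_le_rnorm x y : `|b x y| <= N x * N y.
Proof.
rewrite -(@ler_pXn2r _ 2) ?nnegrE ?mulr_ge0 ?rnorm_ge0 // real_normK ?num_real //.
by rewrite exprMn !rnorm_sqr; exact: rdot_cauchy_schwarz idfun_adj idfun_ge0 _ _.
Qed.

Lemma exists_pow3_lt (e : R) : 0 < e -> exists n, (3 ^+ n)^-1 < e.
Proof.
move=> e0; pose n := (Num.truncn e^-1).+1; exists n.
rewrite invf_plt ?posrE ?exprn_gt0 //; apply: lt_trans (truncnS_gt _) _.
by rewrite -natrX ltr_nat ltn_expl.
Qed.

(** Completeness enters here; 3/2 is the sum of the geometric series of ratio 1/3. *)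
Lemma geometric_cvg (Y : nat -> H) :
  (forall n, N (Y n.+1 - Y n) <= (3 ^+ n)^-1) ->
  exists y, forall n, N (y - Y n) <= 3 / 2 * (3 ^+ n)^-1.
Proof.
move=> hY.
have pow0 n : 0 < (3 ^+ n)^-1 :> R by rewrite invr_gt0 exprn_gt0.
have dist n m : (n <= m)%N -> N (Y n - Y m) <= 3 / 2 * (3 ^+ n)^-1.
  move=> /subnKC <-; move: (m - n)%N => k.
  (* Subtracting the tail makes the induction on [k] telescope. *)
  suff : N (Y n - Y (n + k)%N) <= 3 / 2 * (3 ^+ n)^-1 - 3 / 2 * (3 ^+ (n + k))^-1.
    by have := pow0 (n + k)%N; lra.
  elim: k => [|k IHk]; first by rewrite addn0 !subrr /N normr0.
  have := ler_rnormD (Y n - Y (n + k)%N) (Y (n + k)%N - Y (n + k).+1).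
  rewrite addrA subrK (rdistC (Y (n + k)%N)) addnS exprS invfM.
  have := hY (n + k)%N.
  move: IHk; set p := (3 ^+ (n + k))^-1; lra.
have cY : cvg (Y @ \oo).
  apply/cauchy_cvgP; apply: cauchy_exP => e e0.
  have eR : (complex.Re e)%:C%C = e by exact/ReK/ltW.
  have eR0 : 0 < complex.Re e by rewrite -ltcR eR.
  have [n hn] : exists n, (3 ^+ n)^-1 < complex.Re e / 2.
    by apply: exists_pow3_lt; rewrite divr_gt0.
  exists (Y n); exists n => // m /= nm.
  rewrite -ball_normE /= -rnormK -eR ltcR.
  by apply: le_lt_trans (dist _ _ nm) _; lra.
pose y := lim (Y @ \oo); exists y => n.
apply/ler_addgt0Pr => e e0.
have /cvgr_dist_lt /(_ e%:C%C) := cY.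
rewrite -[X in X < _](rmorph0 (real_complex R)) ltcR => /(_ e0) [k _ hk].
have := hk (maxn k n) (leq_maxl _ _).
rewrite /= -rnormK ltcR => h1.
have h2 := dist n _ (leq_maxr k n).
have := ler_rnormD (y - Y (maxn k n)) (Y (maxn k n) - Y n).
by rewrite addrA subrK (rdistC (Y (maxn k n))); lra.
Qed.

(* Uniform boundedness by a gliding hump, following Sokal: each step moves by
   3 ^- n in the direction +- u n that does not decrease |<u n, y>|, and the
   later steps can undo at most half of the resulting hump. *)
Lemma weakly_bounded_bounded (F : set H) :
  (forall y, exists M, forall u, F u -> `|b u y| <= M) ->
  exists M, forall u, F u -> b u u <= M.
Proof.
move=> wF; apply: contrapT => /forallNP nF.
(* This size makes a hump of height [3 ^- n * N (u n)] exceed [n]. *)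
have /choice [u hu] (n : nat) :
    exists u, F u /\ n%:R * 3 ^+ n < N u.
  have /existsNP [u /not_implyP [Fu /negP]] := nF ((n%:R * 3 ^+ n) ^+ 2).
  rewrite -ltNge -rnorm_sqr => h; exists u; split => //.
  by rewrite -(@ltr_pXn2r _ 2) ?nnegrE ?rnorm_ge0 // mulr_ge0 ?exprn_ge0.
have N0 n : 0 < N (u n).
  by apply: le_lt_trans (hu n).2; rewrite mulr_ge0 ?exprn_ge0.
pose c n := (3 ^+ n)^-1 / N (u n).
have c0 n : 0 < c n by rewrite divr_gt0 ?invr_gt0 ?exprn_gt0.
pose s n y : R := if 0 <= b (u n) y then c n else - c n.
pose Y := fix Y n := if n is m.+1 then Y m + (s m (Y m))%:C%C *: u m else 0.
have cN n : c n * N (u n) = (3 ^+ n)^-1 by rewrite divfK // gt_eqF.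
have [|y hy] := @geometric_cvg Y.
  move=> n; rewrite /= addrC addKr rnormZ -cN.
  by rewrite /s; case: ifP => _; rewrite ?normrN gtr0_norm.
have hump n : (3 ^+ n)^-1 * N (u n) <= `|b (u n) (Y n.+1)|.
  rewrite -cN -mulrA -expr2 rnorm_sqr /= (rdotDr idfun_adj) (rdotZr idfun_adj) /s.
  have cb : 0 <= c n * b (u n) (u n).
    by rewrite mulr_ge0 ?(ltW (c0 n)) // -rnorm_sqr sqr_ge0.
  case: ifPn => [b0|]; last rewrite -ltNge => /ltW b0.
    by rewrite ger0_norm; lra.
  by rewrite mulNr ler0_norm; lra.
have [M hM] := wF y.
(* The limit is within [3 / 2 * 3 ^- n.+1], that is [3 ^- n / 2], of [Y n.+1], so half of the hump
   survives. *)
have hn n : n%:R / 2 < M.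
  have [Fu nu] := hu n.
  have := ler_normD (b (u n) y) (b (u n) (Y n.+1 - y)).
  rewrite -(rdotDr idfun_adj) addrC subrK.
  have := hump n; have := hM _ Fu; have := rdot_le_rnorm (u n) (Y n.+1 - y).
  have := hy n.+1; rewrite rdistC exprS invfM.
  move: nu; rewrite mulrC -ltr_pdivlMl ?exprn_gt0 //.
  set p := (3 ^+ n)^-1; set q := N (Y n.+1 - y); have := N0 n.
  move: (N (u n)) (`|b (u n) (Y n.+1 - y)|) => v t v0 pv qp tq My hp.
  have : v * q <= v * (p / 2) by rewrite ler_pM2l //; lra.
  by lra.
have := hn (Num.truncn (2 * M)).+1; apply/negP; rewrite -leNgt.
by have := truncnS_gt (2 * M); lra.
Qed.

Lemma bounded_op_le (T : {linear H -> H}) : bounded_op T ->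
  exists2 K : R, 0 < K & forall x, b (T x) (T x) <= K * b x x.
Proof.
move=> /linear_boundedP /pinfty_ex_gt0 [M M0 hM].
have MR : (complex.Re M)%:C%C = M by exact/ReK/ltW.
have MR0 : 0 < complex.Re M by rewrite -ltcR MR.
exists (complex.Re M ^+ 2); first by rewrite exprn_gt0.
move=> x; rewrite -!rnorm_sqr -exprMn.
rewrite ler_pXn2r ?nnegrE ?rnorm_ge0 ?(mulr_ge0 (ltW MR0) (rnorm_ge0 _)) //.
by rewrite -lecR rmorphM /= MR !rnormK; exact: hM.
Qed.

Variable A : {linear H -> H}.
Hypothesis posA : positive_op dot A.

Let adjA : forall x y, dot (A x) y = dot x (A y) := posA.1.
Let geA : forall x, 0 <= dot (A x) x := posA.2.

Lemma rdot_idfun x y : Arealdot dot A x y = b (A x) y.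
Proof. by []. Qed.

(* Dual form of Douglas' majorization: range inclusion turns into a norm bound. *)
Lemma adjointable_majorization (T : {linear H -> H}) : A_adjointable dot A T ->
  exists2 C : R, 0 < C &
    forall x, b (A (T x)) (A (T x)) <= C * b (A x) (A x).
Proof.
move=> [_ [Ts [_ adjT rng]]].
pose F := [set A (T x) | x in [set x | b (A x) (A x) <= 1]].
have [|M hM] := @weakly_bounded_bounded F.
  (* Range inclusion supplies [z] with [A z = Ts (A y)], which turns the pairing of [A (T x)] with
     [y] into that of [A x] with [z]. *)
  move=> y; have [|z _ /= Az] := rng (Ts (A y)); first by exists y.
  exists (1 + b z z) => _ [x /= Ax1 <-].
  have -> : b (A (T x)) y = b (A x) z.
    by rewrite /Arealdot /Adot /= adjA adjT -Az adjA.
  by apply: le_trans (rdot_amgm idfun_adj idfun_ge0 _ _) _; rewrite lerD2r.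
exists (`|M| + 1) => [|x]; first by rewrite ltr_wpDl.
have Mp : 0 < `|M| + 1 by rewrite ltr_wpDl.
(* Since [A x] may vanish, [x] is scaled using [d > q] in place of [q]; the slack in [d] costs
   exactly [e]. *)
apply/ler_addgt0Pr => e e0.
set q := b (A x) (A x); have q0 : 0 <= q by exact: rdot_ge0 idfun_ge0 _.
set d := q + e / (`|M| + 1).
have d0 : 0 < d by rewrite ltr_wpDl ?divr_gt0.
set t := (Num.sqrt d)^-1.
have tt : t * t * d = 1.
  by rewrite -invfM -expr2 sqr_sqrtr ?(ltW d0) // mulVf // gt_eqF.
have AZ : A (t%:C%C *: x) = t%:C%C *: A x by rewrite linearZ.
have ATZ : A (T (t%:C%C *: x)) = t%:C%C *: A (T x) by rewrite !linearZ.
have := hM (A (T (t%:C%C *: x))); rewrite ATZ rdotZl (rdotZr idfun_adj) mulrA.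
move=> /(_ _) h.
have {}h : t * t * b (A (T x)) (A (T x)) <= M.
  apply: h; exists (t%:C%C *: x) => //=.
  rewrite AZ rdotZl (rdotZr idfun_adj) mulrA -/q -tt ler_wpM2l //.
    by rewrite -expr2 sqr_ge0.
  by rewrite lerDl ltW // divr_gt0.
have -> : (`|M| + 1) * q + e = (`|M| + 1) * d.
  by rewrite /d; field; rewrite gt_eqF.
have tt0 : 0 < t * t by rewrite -(pmulr_lgt0 _ d0) tt.
rewrite -(ler_pM2l tt0); apply: le_trans h _.
rewrite mulrCA tt mulr1; apply: le_trans (ler_norm _) _.
by rewrite lerDl.
Qed.

(* S := X T with A X = T^* A is symmetric for <., .>_A and |T x|_A^2 = <S x, x>_A. *)
Lemma adjointable_Abounded (T : {linear H -> H}) :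
  A_adjointable dot A T -> Abounded dot A T.
Proof.
move=> hT; have [C C0 hC] := adjointable_majorization hT.
have [_ [Ts [bTs adjT rng]]] := hT.
have [K K0 hK] := bounded_op_le bTs.
(* A bare choice of preimages: the symmetry of [S] follows from [A (X y) = Ts (A y)] alone. *)
have /choice [X hX] y : exists z, A z = Ts (A y).
  by have [|z _ Az] := rng (Ts (A y)); [exists y|exists z].
pose S x := X (T x).
have ST x y : Arealdot dot A (S x) y = Arealdot dot A (T x) (T y).
  rewrite !rdot_idfun /S hX (rdotC idfun_adj) [RHS](rdotC idfun_adj).
  by rewrite /Arealdot /Adot /= adjT.
have Ssym x y : Arealdot dot A (S x) y = Arealdot dot A x (S y).
  by rewrite (rdotC adjA x) !ST (rdotC adjA).
have iter_sym m x y : Arealdot dot A (iter m S x) y = Arealdot dot A x (iter m S y).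
  by elim: m x y => //= m IHm x y; rewrite Ssym IHm -iterSr.
(* As [A (S x) = Ts (A (T x))], each iteration costs [K] for [Ts] and [C] for the majorization. *)
have iter_bnd m x :
    b (A (iter m S x)) (A (iter m S x)) <= (K * C) ^+ m * b (A x) (A x).
  elim: m => [|m IHm]; first by rewrite expr0 mul1r.
  rewrite /= {1 2}/S !hX; apply: le_trans (hK _) _.
  rewrite exprS -!mulrA ler_pM2l //; apply: le_trans (hC _) _.
  by rewrite ler_pM2l // mulrA.
exists (Num.sqrt (K * C)) => x; rewrite -ST.
have q0 := rdot_ge0 geA x.
have KC0 : 0 < K * C by rewrite mulr_gt0.
(* Here [a 1] is the squared A-seminorm of [T x]. Symmetry of [S] and Cauchy-Schwarz for [A] give
   the doubling bound; Cauchy-Schwarz for [dot] and [iter_bnd] give the growth bound. *)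
have := @krein_iteration R (fun m => Arealdot dot A (iter m S x) x) (K * C)
  (b (A x) (A x) * b x x) KC0.
move=> /= kr; apply: le_trans (ler_norm _) _.
rewrite -(@ler_pXn2r _ 2) ?nnegrE ?mulr_ge0 ?sqrtr_ge0 //.
rewrite real_normK ?num_real // exprMn sqr_sqrtr ?(ltW KC0) //.
apply: kr => m.
  rewrite muln2 -addnn iterD (iter_sym _ (iter m S x)) mulrC.
  exact: rdot_cauchy_schwarz.
rewrite rdot_idfun mulrA; apply: le_trans (rdot_cauchy_schwarz idfun_adj idfun_ge0 _ _) _.
by rewrite ler_wpM2r // (rdot_ge0 idfun_ge0).
Qed.

End HilbertBoundedness.

Theorem corollary3p1 (R : realType) (H : completeNormedModType R[i])
    (dot : inner_product H)
    (norm_dot : forall x : H, `|x| ^+ 2 = dot x x)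
    (A : {linear H -> H}) (bndA : bounded_op A) (posA : positive_op dot A)
    (T1 T2 T3 T4 : {linear H -> H})
    (hT1 : A_adjointable dot A T1) (hT2 : A_adjointable dot A T2)
    (hT3 : A_adjointable dot A T3) (hT4 : A_adjointable dot A T4) :
  Anumradius (dsum_dot dot) (block_op A \0 \0 A) (block_op T1 T2 T3 T4) >=
  Num.max (Num.max (Num.max
    (Anumradius dot A T1)
    (Anumradius dot A T4))
    ((Num.sqrt 2)^-1 *
       Num.sqrt (Anumradius dot A ((T2 \o T3) \+ (T3 \o T2)))))
    ((Num.sqrt 2)^-1 *
       Num.sqrt (Anumradius dot A ((T2 \o T3) \- (T3 \o T2)))).
Proof.
have [adjA geA] := posA.
have bnd := Abounded_block adjA geA (adjointable_Abounded norm_dot posA hT1)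
  (adjointable_Abounded norm_dot posA hT2) (adjointable_Abounded norm_dot posA hT3)
  (adjointable_Abounded norm_dot posA hT4).
rewrite !ge_max Anumradius_block_diagl // Anumradius_block_diagr //=.
by rewrite !sqrt_Anumradius_le // ?Anumradius_anticommutator_le
  ?Anumradius_commutator_le.
Qed.
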